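(* The period tripling renormalization operator $R$ defined on the space of $C^{1+Lip}$ unimodal maps has positive topological entropy.
   Context: A unimodal map is a $C^1$ map $f:[0,1]\to[0,1]$ with a unique critical point $c$, normalized here by $f(c)=1$, $f(1)=0$. It is $C^{1+Lip}$ if its derivative is Lipschitz. $f$ is period tripling renormalizable if $f(0)<c<f^4(0)$ and, with $J=[f(0),f^4(0)]$ a proper subinterval, the intervals $f^2(J),J,f(J)$ have pairwise disjoint interiors, lie in this order from left to right, and $f^3(J)\subset J$. Then $Rf=h^{-1}\circ f^3\circ h$ with $h:[0,1]\to J$ the orientation reversing affine homeomorphism; the operator $R$ is defined on the set of period tripling renormalizable $C^{1+Lip}$ unimodal maps. The topological entropy of $R$ is the supremum of $h_{top}(R|_\Lambda)$ over compact (in the $C^1$ topology) sets $\Lambda$ in its domain with $R(\Lambda)\subset\Lambda$ on which $R$ is continuous. *)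

(* Defs.v *)
From HB Require Import structures.
From mathcomp Require Import all_boot all_order all_algebra finmap.
From mathcomp Require Import all_classical all_reals all_analysis.

Set Implicit Arguments.
Unset Strict Implicit.
Unset Printing Implicit Defensive.

Import Order.TTheory GRing.Theory Num.Theory.
Import numFieldNormedType.Exports.

Local Open Scope classical_set_scope.
Local Open Scope ring_scope.

Definition unit_itv (R : realType) : set R := `[0, 1].

(* At the endpoints of [0, 1] the increments stay in [0, 1], so these are the
   one-sided derivatives there. *)
Definition diff_quot (R : realType) (f : R -> R) (x y : R) : R :=
  (f y - f x) / (y - x).

Definition derivable01 (R : realType) (f : R -> R) (x : R) : Prop :=
  cvg (diff_quot f x y @[y --> within (@unit_itv R) x^']).

Definition deriv01 (R : realType) (f : R -> R) (x : R) : R :=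
  lim (diff_quot f x y @[y --> within (@unit_itv R) x^']).

Definition C1 (R : realType) (f : R -> R) : Prop :=
  (forall x, unit_itv x -> derivable01 f x) /\
  {within @unit_itv R, continuous (deriv01 f)}.

Definition C1Lip (R : realType) (f : R -> R) : Prop :=
  C1 f /\ [lipschitz (deriv01 f x) | x in @unit_itv R].

(* The C^1 topology: uniform convergence on [0, 1] of the map and of its
   derivative.  A map on [0, 1] is represented by its extension by zero to the
   whole line (see [unimodal]), so that agreement on [0, 1] is equality.  The
   carrier contains all functions, but only C^1 maps on [0, 1] are used. *)
Definition jet1 (R : realType) (f : R -> R) :
    arrow_uniform_type R R * arrow_uniform_type R R :=
  (f \_ (@unit_itv R), deriv01 f \_ (@unit_itv R)).

Definition C1space (R : realType) : pseudoMetricType R :=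
  initial_topology (@jet1 R).

Definition critical_points (R : realType) (f : R -> R) : set R :=
  [set x | unit_itv x /\ deriv01 f x = 0].

Definition unimodal (R : realType) (f : R -> R) (c : R) : Prop :=
  [/\ f \_ (@unit_itv R) = f,
      f @` (@unit_itv R) `<=` @unit_itv R,
      C1 f,
      critical_points f = [set c] &
      f c = 1 /\ f 1 = 0].

Definition interiors_disjoint (R : realType) (A B : set R) : Prop :=
  interior A `&` interior B = set0.

Definition left_of (R : realType) (A B : set R) : Prop :=
  forall x y, A x -> B y -> x <= y.

Definition tripling_itv (R : realType) (f : R -> R) : set R :=
  `[f 0, iter 4 f 0].

Definition renormalizable (R : realType) (f : R -> R) : Prop :=
  let J := tripling_itv f in
  exists c : R,
    [/\ unimodal f c,
        f 0 < c < iter 4 f 0,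
        J `<` @unit_itv R,
        [/\ interiors_disjoint (iter 2 f @` J) J,
            interiors_disjoint J (f @` J),
            interiors_disjoint (iter 2 f @` J) (f @` J),
            left_of (iter 2 f @` J) J &
            left_of J (f @` J)] &
        iter 3 f @` J `<=` J].

(* [line_path b a] is the affine map sending 0 to b and 1 to a, and
   [factor b a] is its inverse; here J = [a, b], so it reverses orientation.
   The operator is only meaningful on [renorm_domain]. *)
Definition renorm (R : realType) (f : C1space R) : C1space R :=
  let a := f 0 in
  let b := iter 4 f 0 in
  (factor b a \o iter 3 f \o line_path b a) \_ (@unit_itv R).

Definition renorm_domain (R : realType) : set (C1space R) :=
  [set f | renormalizable f /\ C1Lip f].

(* Bowen's definition: [separated_for F A n e E] says that distinct points of
   E are at distance at least e for the metric
   d_n(x, y) = max_(i < n) d(F^i x, F^i y). *)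
Definition separated_for (R : realType) (T : pseudoMetricType R)
    (F : T -> T) (A : set T) (n : nat) (e : R) (E : {fset T}) : Prop :=
  [set` E] `<=` A /\
  forall x y, x \in E -> y \in E -> x != y ->
    exists2 i, (i < n)%N & ~ ball (iter i F x) e (iter i F y).

Definition separation_number (R : realType) (T : pseudoMetricType R)
    (F : T -> T) (A : set T) (n : nat) (e : R) : \bar R :=
  ereal_sup [set (#|` E|%:R)%:E | E in [set E | separated_for F A n e E]].

Definition separation_growth (R : realType) (T : pseudoMetricType R)
    (F : T -> T) (A : set T) (e : R) : \bar R :=
  limn_esup (fun n => (n%:R^-1)%:E * lne (separation_number F A n e))%E.

(* The growth rate is nonincreasing in e, so the supremum over e > 0 is the
   limit as e tends to 0. *)
Definition topological_entropy (R : realType) (T : pseudoMetricType R)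
    (F : T -> T) (A : set T) : \bar R :=
  ereal_sup [set separation_growth F A e | e in [set e : R | 0 < e]].

Definition admissible_set (R : realType) (L : set (C1space R)) : Prop :=
  [/\ compact L,
      L `<=` @renorm_domain R,
      @renorm R @` L `<=` L &
      {within L, continuous (@renorm R)}].

Definition renorm_entropy (R : realType) : \bar R :=
  ereal_sup [set topological_entropy (@renorm R) L |
             L in [set L | admissible_set L]].

(* Main.v *)
Require Import Defs.
From mathcomp Require Import all_boot all_order all_algebra finmap.
From mathcomp Require Import all_classical all_reals all_analysis.
From mathcomp Require Import ring lra.

(** A family of maps on which renormalization acts as the full shift on two
    symbols.

    The maps have critical point 1/2 and J = [3/8, 5/8], and they are affine
    both on [31/32, 1], which is mapped onto [0, 1/8], and on [0, 1/8], which
    is mapped onto J.  Hence f^3 restricted to J is f followed by an affine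
    map, and the condition that f renormalizes to g becomes linear: writing
    f(x) = 1 - F(x - 1/2) and g(x) = 1 - G(x - 1/2), it reads
    F(u) = G(-4 u) / 32 for |u| <= 1/8 ([renorm_chaotic_map]).  Outside J and
    the two affine pieces nothing is prescribed but the smoothness and
    monotonicity of f, and this freedom encodes one bit at each scale.

    Every F is built from scaled copies of two blocks B_0 and B_1, one of them
    at each scale: for a word w of bits,
    F_w(u) = sum_n (1/32)^n B_(w n)((-4)^n u).  The blocks vanish on
    [-1/8, 1/8], so renormalization shifts w.  They are constant outside
    [-1, 1], so the scales n >= 1 only add a constant to F_w on the two affine
    pieces and at the place where B_0 and B_1 differ.

    The vertical scaling 1/32 is less than (1/4)^2.  So the critical point is
    degenerate, and the sum of the series of the derivatives is Lipschitz: the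
    n-th term has a Lipschitz constant proportional to (1/2)^n.

    The blocks have a piecewise affine derivative with the sign of u, nonzero
    for 1/8 < |u| <= 1/2.  Each u <> 0 of [-1/2, 1/2] is brought into this
    fundamental domain by some power of u |-> -4 u, so 1/2 is the only critical
    point ([mul_dprofile_gt0]).

    The maps form a continuous image of the Cantor space, hence a compact set
    ([chaotic_set_admissible]).  The 2^n words of length n followed by zeros
    give maps that are separated within n steps, since B_0 and B_1 differ by
    1/64 at the point 27/64 ([renorm_separates]).  So the entropy is at least
    ln 2 ([separation_growth_ge]). *)

Set Implicit Arguments.
Unset Strict Implicit.
Unset Printing Implicit Defensive.

Import Order.TTheory GRing.Theory Num.Theory.
Import numFieldNormedType.Exports.

Local Open Scope classical_set_scope.
Local Open Scope ring_scope.

(** * Series with geometric bounds, and a monotonicity criterion *)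

Lemma geometric_dominated_cvg (R : realType) (a : R ^nat) (C q : R) :
  0 <= q < 1 -> (forall n, `|a n| <= C * q ^+ n) -> cvgn (series a).
Proof.
move=> /andP[q0 q1] aC; apply: normed_cvg.
apply: (@series_le_cvg _ _ (geometric C q)) => //.
- by move=> n; exact: normr_ge0.
- by move=> n; exact: le_trans (normr_ge0 _) (aC n).
- by apply: is_cvg_geometric_series; rewrite ger0_norm.
Qed.

Lemma geometric_dominated_lim (R : realType) (a : R ^nat) (C q : R) :
  0 <= q < 1 -> (forall n, `|a n| <= C * q ^+ n) ->
  `|limn (series a)| <= C / (1 - q).
Proof.
move=> /andP[q0 q1] aC.
have gq : series (geometric C q) @ \oo --> C / (1 - q).
  by apply: cvg_geometric_series; rewrite ger0_norm.
have cn : cvgn [normed series a].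
  apply: (@series_le_cvg _ _ (geometric C q)) => //.
  - by move=> n; exact: normr_ge0.
  - by move=> n; exact: le_trans (normr_ge0 _) (aC n).
  - by apply/cvg_ex; eexists; exact: gq.
apply: (le_trans (lim_series_norm cn)).
rewrite -(cvg_lim (@Rhausdorff R) gq).
apply: lim_series_le => //.
by apply/cvg_ex; eexists; exact: gq.
Qed.

Lemma lim_seriesS (R : realType) (a : R ^nat) : cvgn (series a) ->
  limn (series a) = a 0%N + limn (series (fun n => a n.+1)).
Proof.
move=> ca; have sE n : series a n.+1 = a 0%N + series (fun n => a n.+1) n.
  by rewrite /series /= big_nat_recl.
have caS : cvgn (series (fun n => a n.+1)).
  have -> : series (fun n => a n.+1) = (fun n => series a (n + 1)%N - a 0%N).
    by apply/funext => n; rewrite addn1 sE addrAC subrr add0r.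
  apply: is_cvgB; last exact: is_cvg_cst.
  by apply/cvg_ex; exists (limn (series a)); rewrite (cvg_shiftn 1 (series a)).
have /(cvg_lim (@Rhausdorff R)) <- : (fun n => series a (n + 1)%N) @ \oo
    --> a 0%N + limn (series (fun n => a n.+1)).
  under eq_fun do rewrite addn1 sE.
  by apply: cvgD caS; exact: cvg_cst.
apply/esym/(cvg_lim (@Rhausdorff R)).
by rewrite (cvg_shiftn 1 (series a)).
Qed.

Lemma is_cvg_seriesM (R : realType) (a : R ^nat) (c : R) :
  cvgn (series a) -> cvgn (series (fun n => c * a n)).
Proof. exact: is_cvg_seriesZ. Qed.

Lemma lim_seriesM (R : realType) (a : R ^nat) (c : R) :
  cvgn (series a) -> limn (series (fun n => c * a n)) = c * limn (series a).
Proof. exact: lim_seriesZ. Qed.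

(** Used for every identity that follows from a self-similarity: iterating the
    functional equation contracts the defect. *)
Lemma eq0_geometric_bound (R : realType) (x C q : R) : 0 <= q < 1 ->
  (forall n, `|x| <= C * q ^+ n) -> x = 0.
Proof.
move=> /andP[q0 q1] xC; apply/eqP; rewrite -normr_le0.
have gq : geometric C q @ \oo --> 0.
  by apply: cvg_geometric; rewrite ger0_norm.
rewrite -(cvg_lim (@Rhausdorff R) gq).
apply: limr_ge; first by apply/cvg_ex; eexists; exact: gq.
by apply: nearW => n; exact: xC.
Qed.

(** On an interval of length l the Taylor bound allows a decrease of at most
    K l^2.  Bisecting n times replaces this by 2^n K (l / 2^n)^2, which tends
    to 0. *)
Lemma taylor_nondecreasing (R : realType) (F G : R -> R) (K a b : R) :
  (forall x y, `|F y - F x - G x * (y - x)| <= K * (y - x) ^+ 2) ->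
  (forall x, a <= x <= b -> 0 <= G x) -> a <= b -> F a <= F b.
Proof.
move=> FG G0 ab; rewrite leNgt; apply/negP => Fba.
have : F a - F b = 0.
  apply: (@eq0_geometric_bound _ _ (K * (b - a) ^+ 2) (1 / 2)); first lra.
  move=> n; rewrite ger0_norm; last lra.
  clear Fba; elim: n a b ab G0 => [|n IH] a b ab G0.
    have := FG a b; rewrite ler_norml expr0 mulr1 => /andP[+ _].
    have : 0 <= G a * (b - a).
      by apply: mulr_ge0; [apply: G0|]; lra.
    by lra.
  pose m := (a + b) / 2.
  have am : a <= m by rewrite /m; lra.
  have mb : m <= b by rewrite /m; lra.
  have Ga x : a <= x <= m -> 0 <= G x.
    by move=> /andP[ax xm]; apply: G0; lra.
  have Gb x : m <= x <= b -> 0 <= G x.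
    by move=> /andP[mx xb]; apply: G0; lra.
  have := lerD (IH _ _ am Ga) (IH _ _ mb Gb).
  rewrite (_ : m - a = (b - a) / 2); last by rewrite /m; field.
  rewrite (_ : b - m = (b - a) / 2); last by rewrite /m; field.
  rewrite (_ : F a - F m + (F m - F b) = F a - F b); last by ring.
  move=> /le_trans; apply.
  by rewrite [_ ^+ n.+1]exprS; move: (_ ^+ n) => q; lra.
by lra.
Qed.

(** * The two blocks *)

Definition pos_part (R : realType) (x : R) : R := Num.max x 0.

Definition half_sq (R : realType) (x : R) : R := pos_part x ^+ 2 / 2.

Lemma pos_part_id (R : realType) (x : R) : 0 <= x -> pos_part x = x.
Proof. by move=> x0; rewrite /pos_part max_l. Qed.

Lemma pos_part_0 (R : realType) (x : R) : x <= 0 -> pos_part x = 0.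
Proof. by move=> x0; rewrite /pos_part max_r. Qed.

Lemma half_sq_id (R : realType) (x : R) : 0 <= x -> half_sq x = x ^+ 2 / 2.
Proof. by move=> x0; rewrite /half_sq pos_part_id. Qed.

Lemma half_sq_0 (R : realType) (x : R) : x <= 0 -> half_sq x = 0.
Proof. by move=> x0; rewrite /half_sq pos_part_0// expr0n mul0r. Qed.

Lemma pos_part_lip (R : realType) (x y : R) :
  `|pos_part x - pos_part y| <= `|x - y|.
Proof.
rewrite /pos_part; case: (leP x 0) => ?; case: (leP y 0) => ?;
  rewrite ler_norml; apply/andP; split;
  case: (lerP x y) => ?; lra.
Qed.

Lemma half_sq_taylor (R : realType) (x y : R) :
  `|half_sq y - half_sq x - pos_part x * (y - x)| <= (y - x) ^+ 2 / 2.
Proof.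
rewrite /half_sq; have [x0|/ltW x0] := leP x 0; have [y0|/ltW y0] := leP y 0;
  rewrite ?(pos_part_0 x0) ?(pos_part_id x0) ?(pos_part_0 y0) ?(pos_part_id y0);
  have xy2 := sqr_ge0 (y - x); have x2 := sqr_ge0 x; have y2 := sqr_ge0 y;
  rewrite ler_norml; apply/andP; split; try lra.
- have := mulr_le0_ge0 x0 y0; lra.
- have := mulr_ge0_le0 x0 y0; lra.
Qed.

(** The three combinations below are used with h = [pos_part], which gives
    piecewise affine slopes, and with h = [half_sq], which gives the
    antiderivatives of these slopes.

    On the right the slope rises from 0 at 1/8 to 4 at 25/64, keeps this value
    until 1/2, and returns to 0 at 1.  The value 4 is |[0, 1/8]| / |[31/32, 1]|,
    and the break 25/64 is chosen so that the profiles below take the value 1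
    at 1/2. *)
Definition right_comb (R : realType) (h : R -> R) (u : R) : R :=
  256 / 17 * (h (u - 1 / 8) - h (u - 25 / 64))
  - 8 * (h (u - 1 / 2) - h (u - 1)).

(** In v = - u the slope rises from 0 at 1/8 to 2 at 5/16, keeps this value
    until 1/2, and returns to 0 at 7/8.  Here 2 = |J| / |[0, 1/8]|, and the
    break 5/16 makes the profiles take the value 5/8 at -1/2. *)
Definition left_comb (R : realType) (h : R -> R) (v : R) : R :=
  32 / 3 * (h (v - 1 / 8) - h (v - 5 / 16))
  - 16 / 3 * (h (v - 1 / 2) - h (v - 7 / 8)).

(** The difference of the two blocks: its slope is a hat of height 1 followed
    by the opposite hat, so it integrates to 0.  It lives on [25/64, 29/64],
    where the slope of [right_comb] is 4: adding it keeps the slope positive,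
    and changes neither the piece [15/32, 1/2] nor the tails. *)
Definition wiggle_comb (R : realType) (h : R -> R) (u : R) : R :=
  64 * (h (u - 25 / 64) - 2 * h (u - 26 / 64)
        + 2 * h (u - 28 / 64) - h (u - 29 / 64)).

Definition block (R : realType) (b : bool) (u : R) : R :=
  right_comb (@half_sq R) u + b%:R * wiggle_comb (@half_sq R) u
  + left_comb (@half_sq R) (- u).

Definition dblock (R : realType) (b : bool) (u : R) : R :=
  right_comb (@pos_part R) u + b%:R * wiggle_comb (@pos_part R) u
  - left_comb (@pos_part R) (- u).

Lemma block_taylor (R : realType) (b : bool) (x y : R) :
  `|block b y - block b x - dblock b x * (y - x)| <= 256 * (y - x) ^+ 2.
Proof.
have H k : `|half_sq (y - k) - half_sq (x - k) - pos_part (x - k) * (y - x)|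
             <= (y - x) ^+ 2 / 2.
  have := half_sq_taylor (x - k) (y - k).
  by have -> : y - k - (x - k) = y - x by ring.
have K k : `|half_sq (- y - k) - half_sq (- x - k)
             + pos_part (- x - k) * (y - x)| <= (y - x) ^+ 2 / 2.
  have := half_sq_taylor (- x - k) (- y - k).
  have -> : - y - k - (- x - k) = - (y - x) by ring.
  by rewrite sqrrN mulrN opprK.
rewrite /block /dblock /right_comb /left_comb /wiggle_comb.
move: (H (1 / 8)) (H (25 / 64)) (H (1 / 2)) (H 1).
move: (H (26 / 64)) (H (28 / 64)) (H (29 / 64)).
move: (K (1 / 8)) (K (5 / 16)) (K (1 / 2)) (K (7 / 8)).
rewrite !ler_norml.
do 11! (move=> /andP[? ?]).
by apply/andP; case: b; rewrite ?mulr1n ?mulr0n; split; lra.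
Qed.

Lemma dblock_lip (R : realType) (b : bool) (x y : R) :
  `|dblock b x - dblock b y| <= 512 * `|x - y|.
Proof.
have H k : `|pos_part (x - k) - pos_part (y - k)| <= `|x - y|.
  have := pos_part_lip (x - k) (y - k).
  by have -> : x - k - (y - k) = x - y by ring.
have K k : `|pos_part (- x - k) - pos_part (- y - k)| <= `|x - y|.
  have := pos_part_lip (- x - k) (- y - k).
  have -> : - x - k - (- y - k) = - (x - y) by ring.
  by rewrite normrN.
rewrite /dblock /right_comb /left_comb /wiggle_comb.
move: (H (1 / 8)) (H (25 / 64)) (H (1 / 2)) (H 1).
move: (H (26 / 64)) (H (28 / 64)) (H (29 / 64)).
move: (K (1 / 8)) (K (5 / 16)) (K (1 / 2)) (K (7 / 8)).
move: `|x - y| => d.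
rewrite !ler_norml.
do 11! (move=> /andP[? ?]).
by apply/andP; case: b; rewrite ?mulr1n ?mulr0n; split; lra.
Qed.

Lemma block_core (R : realType) (b : bool) (u : R) :
  `|u| <= 1 / 8 -> block b u = 0.
Proof.
rewrite ler_norml => /andP[? ?].
rewrite /block /right_comb /left_comb /wiggle_comb !half_sq_0; first ring.
all: lra.
Qed.

Lemma dblock_core (R : realType) (b : bool) (u : R) :
  `|u| <= 1 / 8 -> dblock b u = 0.
Proof.
rewrite ler_norml => /andP[? ?].
rewrite /dblock /right_comb /left_comb /wiggle_comb !pos_part_0; first ring.
all: lra.
Qed.

(** The constants 63/32 = 2 - 1/32 and 15/16 = 1 - 2/32 are those for which
    the profiles equal 2 and 1 on the two tails, see [profile_tail]. *)
Lemma block_right_tail (R : realType) (b : bool) (u : R) :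
  1 <= u -> block b u = 63 / 32.
Proof.
move=> u1; rewrite /block /right_comb /left_comb /wiggle_comb.
rewrite ![half_sq (- u - _)]half_sq_0; try lra.
by rewrite !half_sq_id; try lra.
Qed.

Lemma block_left_tail (R : realType) (b : bool) (u : R) :
  u <= -1 -> block b u = 15 / 16.
Proof.
move=> u1; rewrite /block /right_comb /left_comb /wiggle_comb.
rewrite ![half_sq (u - _)]half_sq_0; try lra.
by rewrite !half_sq_id; try lra.
Qed.

Lemma dblock_tail (R : realType) (b : bool) (u : R) :
  u <= - (7 / 8) \/ 1 <= u -> dblock b u = 0.
Proof.
case=> ?; rewrite /dblock /right_comb /left_comb /wiggle_comb.
- rewrite ![pos_part (u - _)]pos_part_0; try lra.
  by rewrite !pos_part_id; try lra.
- rewrite ![pos_part (- u - _)]pos_part_0; try lra.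
  by rewrite !pos_part_id; try lra.
Qed.

Lemma block_right_affine (R : realType) (b : bool) (u : R) :
  15 / 32 <= u <= 1 / 2 -> block b u = 31 / 32 - 4 * (1 / 2 - u).
Proof.
move=> /andP[? ?]; rewrite /block /right_comb /left_comb /wiggle_comb.
rewrite ![half_sq (- u - _)]half_sq_0; try lra.
rewrite [half_sq (u - 1 / 2)]half_sq_0 ?[half_sq (u - 1)]half_sq_0; try lra.
by rewrite !half_sq_id; try lra.
Qed.

Lemma block_left_affine (R : realType) (b : bool) (u : R) :
  - (1 / 2) <= u <= - (3 / 8) -> block b u = 9 / 16 - 2 * (u + 1 / 2).
Proof.
move=> /andP[? ?]; rewrite /block /right_comb /left_comb /wiggle_comb.
rewrite ![half_sq (u - _)]half_sq_0; try lra.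
rewrite [half_sq (- u - 1 / 2)]half_sq_0 ?[half_sq (- u - 7 / 8)]half_sq_0;
  try lra.
by rewrite !half_sq_id; try lra.
Qed.

(** At 27/64, between the two opposite hats, the wiggle is largest. *)
Lemma block_probe (R : realType) (b : bool) :
  block b (27 / 64 : R) = block false (27 / 64) + b%:R / 64.
Proof.
rewrite /block; have -> : wiggle_comb (@half_sq R) (27 / 64) = 1 / 64.
  rewrite /wiggle_comb [half_sq (_ - 28 / 64)]half_sq_0
    ?[half_sq (_ - 29 / 64)]half_sq_0; try lra.
  by rewrite !half_sq_id; try lra.
by rewrite mulr0n; lra.
Qed.

(** Branches whose position of u relative to the knots is contradictory are
    discarded at once; otherwise the number of cases doubles at each knot. *)
Ltac case_pos_parts :=
  repeat match goal with |- context [pos_part ?x] =>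
    let h := fresh in
    have [h|h] := leP x 0;
    [rewrite ?(pos_part_0 h)|rewrite ?(pos_part_id (ltW h))];
    try (exfalso; lra)
  end.

Lemma dblock_right_gt0 (R : realType) (b : bool) (u : R) :
  1 / 8 < u < 1 -> 0 < dblock b u.
Proof.
move=> /andP[? ?]; rewrite /dblock /right_comb /left_comb /wiggle_comb.
rewrite ![pos_part (- u - _)]pos_part_0; try lra.
by case: b; rewrite ?mulr1n ?mulr0n ?mul0r ?mul1r; case_pos_parts; lra.
Qed.

Lemma dblock_left_lt0 (R : realType) (b : bool) (u : R) :
  - (7 / 8) < u < - (1 / 8) -> dblock b u < 0.
Proof.
move=> /andP[? ?]; rewrite /dblock /right_comb /left_comb /wiggle_comb.
rewrite ![pos_part (u - _)]pos_part_0; try lra.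
by case_pos_parts; lra.
Qed.

Lemma mul_dblock_gt0 (R : realType) (b : bool) (u : R) :
  1 / 8 < `|u| < 7 / 8 -> 0 < u * dblock b u.
Proof.
rewrite ltr_normr ltr_norml => /andP[/orP[|] ? /andP[? ?]].
- by rewrite mulr_gt0 ?dblock_right_gt0//; lra.
- by rewrite nmulr_rgt0 ?dblock_left_lt0//; lra.
Qed.

Lemma mul_dblock_ge0 (R : realType) (b : bool) (u : R) : 0 <= u * dblock b u.
Proof.
have [u8|u8] := leP `|u| (1 / 8); first by rewrite dblock_core ?mulr0.
have [ul|ul] := leP u (- (7 / 8)).
  by rewrite dblock_tail ?mulr0//; left.
have [ur|ur] := leP 1 u; first by rewrite dblock_tail ?mulr0//; right.
move: u8; rewrite ltr_normr => /orP[|] ?.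
- by rewrite mulr_ge0 ?ltW ?dblock_right_gt0//; lra.
- by rewrite nmulr_rge0 ?ltW ?dblock_left_lt0//; lra.
Qed.

Lemma block_bound (R : realType) (b : bool) (u : R) : `|block b u| <= 256.
Proof.
have [u1|u1] := leP `|u| 1.
  have := block_taylor b 0 u.
  rewrite (@block_core _ b 0) ?dblock_core ?normr0; try lra.
  rewrite mul0r !subr0 => /le_trans; apply.
  have : `|u| ^+ 2 <= 1 by rewrite expr_le1.
  by rewrite real_normK ?num_real// => ?; lra.
move: u1; rewrite ltr_normr => /orP[|] ?.
- by rewrite block_right_tail ?ger0_norm; lra.
- by rewrite block_left_tail ?ger0_norm; lra.
Qed.

Lemma dblock_bound (R : realType) (b : bool) (u : R) : `|dblock b u| <= 512.
Proof.
have [u1|u1] := leP `|u| 1.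
  have := dblock_lip b u 0; rewrite (@dblock_core _ b 0) ?normr0; last lra.
  by rewrite !subr0 => /le_trans; apply; lra.
rewrite (_ : dblock b u = 0) ?normr0; first lra.
apply: dblock_tail; move: u1; rewrite ltr_normr => /orP[|] ?.
- by right; lra.
- by left; lra.
Qed.

(** * Self-similar profiles *)

Definition shift_word (w : nat -> bool) : nat -> bool := fun n => w n.+1.

Definition profile_term (R : realType) (w : nat -> bool) (u : R) (n : nat)
    : R :=
  (1 / 32) ^+ n * block (w n) ((-4) ^+ n * u).

(** The factor (- (1/8))^n is (1/32)^n (-4)^n, so these are the derivatives of
    the terms of the profile. *)
Definition dprofile_term (R : realType) (w : nat -> bool) (u : R) (n : nat)
    : R :=
  (- (1 / 8)) ^+ n * dblock (w n) ((-4) ^+ n * u).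

Definition profile (R : realType) (w : nat -> bool) (u : R) : R :=
  limn (series (profile_term w u)).

Definition dprofile (R : realType) (w : nat -> bool) (u : R) : R :=
  limn (series (dprofile_term w u)).

Lemma profile_term_bound (R : realType) (w : nat -> bool) (u : R) (n : nat) :
  `|profile_term w u n| <= 256 * (1 / 32) ^+ n.
Proof.
have q0 : 0 <= (1 / 32 : R) ^+ n by apply: exprn_ge0; lra.
by rewrite normrM (ger0_norm q0) mulrC ler_wpM2r// block_bound.
Qed.

Lemma dprofile_term_bound (R : realType) (w : nat -> bool) (u : R) (n : nat) :
  `|dprofile_term w u n| <= 512 * (1 / 8) ^+ n.
Proof.
have q0 : 0 <= (1 / 8 : R) ^+ n by apply: exprn_ge0; lra.
rewrite normrM normrX normrN (@ger0_norm _ (1 / 8)); last lra.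
by rewrite mulrC ler_wpM2r// dblock_bound.
Qed.

Lemma profile_cvg (R : realType) (w : nat -> bool) (u : R) :
  cvgn (series (profile_term w u)).
Proof.
by apply: (geometric_dominated_cvg _ (profile_term_bound w u)); lra.
Qed.

Lemma dprofile_cvg (R : realType) (w : nat -> bool) (u : R) :
  cvgn (series (dprofile_term w u)).
Proof.
by apply: (geometric_dominated_cvg _ (dprofile_term_bound w u)); lra.
Qed.

Lemma profile_rec (R : realType) (w : nat -> bool) (u : R) :
  profile w u = block (w 0%N) u + profile (shift_word w) (- 4 * u) / 32.
Proof.
rewrite /profile lim_seriesS; last exact: profile_cvg.
rewrite {1}/profile_term !expr0 !mul1r; congr (_ + _).
rewrite mulrC -lim_seriesM; last exact: profile_cvg.
congr (limn (series _)); apply/funext => n.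
rewrite /profile_term /shift_word /=.
have -> : (-4) ^+ n.+1 * u = (-4) ^+ n * (- 4 * u) by rewrite exprS; ring.
by rewrite exprS; field.
Qed.

Lemma dprofile_rec (R : realType) (w : nat -> bool) (u : R) :
  dprofile w u = dblock (w 0%N) u - dprofile (shift_word w) (- 4 * u) / 8.
Proof.
rewrite /dprofile lim_seriesS; last exact: dprofile_cvg.
rewrite {1}/dprofile_term !expr0 !mul1r; congr (_ + _).
rewrite mulrC -mulNr -lim_seriesM; last exact: dprofile_cvg.
congr (limn (series _)); apply/funext => n.
rewrite /dprofile_term /shift_word /=.
have -> : (-4) ^+ n.+1 * u = (-4) ^+ n * (- 4 * u) by rewrite exprS; ring.
by rewrite exprS; field.
Qed.

(** The Taylor remainder of the n-th term is at most a multiple of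
    (1/32)^n 16^n = (1/2)^n, so the remainders can be summed: this bound for
    the profile contains its differentiability and gives its derivative. *)
Lemma profile_taylor (R : realType) (w : nat -> bool) (x y : R) :
  `|profile w y - profile w x - dprofile w x * (y - x)| <= 512 * (y - x) ^+ 2.
Proof.
have cy := @profile_cvg _ w y; have cx := @profile_cvg _ w x.
have cd := @dprofile_cvg _ w x.
rewrite /profile /dprofile -lim_seriesB// mulrC -lim_seriesM// -lim_seriesB;
  [|exact: is_cvg_seriesB|exact: is_cvg_seriesM].
have -> : 512 * (y - x) ^+ 2 = 256 * (y - x) ^+ 2 / (1 - 1 / 2) :> R by field.
apply: geometric_dominated_lim => [|n]; first lra.
rewrite /profile_term /dprofile_term !fctE /=.
set l := (-4) ^+ n; have q0 : 0 <= (1 / 32 : R) ^+ n by apply: exprn_ge0; lra.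
have lE : (- (1 / 8)) ^+ n = (1 / 32) ^+ n * l.
  by rewrite /l -exprMn; congr (_ ^+ _); field.
have l2E : (1 / 2) ^+ n = (1 / 32) ^+ n * l ^+ 2.
  by rewrite /l -exprM mulnC exprM -exprMn; congr (_ ^+ _); field.
rewrite lE l2E.
have -> : (1 / 32) ^+ n * block (w n) (l * y)
    - (1 / 32) ^+ n * block (w n) (l * x)
    - (y - x) * ((1 / 32) ^+ n * l * dblock (w n) (l * x))
  = (1 / 32) ^+ n * (block (w n) (l * y) - block (w n) (l * x)
      - dblock (w n) (l * x) * (l * y - l * x)) by ring.
rewrite normrM (ger0_norm q0).
have -> : 256 * (y - x) ^+ 2 * ((1 / 32) ^+ n * l ^+ 2)
  = (1 / 32) ^+ n * (256 * (l * y - l * x) ^+ 2) by ring.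
by rewrite ler_wpM2l// block_taylor.
Qed.

Lemma dprofile_lip (R : realType) (w : nat -> bool) (x y : R) :
  `|dprofile w x - dprofile w y| <= 1024 * `|x - y|.
Proof.
have cx := @dprofile_cvg _ w x; have cy := @dprofile_cvg _ w y.
rewrite /dprofile -lim_seriesB//.
have -> : 1024 * `|x - y| = 512 * `|x - y| / (1 - 1 / 2) :> R by field.
apply: geometric_dominated_lim => [|n]; first lra.
rewrite /dprofile_term /= !fctE /= -mulrBr normrM normrX normrN.
rewrite (@ger0_norm _ (1 / 8)); last lra.
have q0 : 0 <= (1 / 8 : R) ^+ n by apply: exprn_ge0; lra.
have -> : 512 * `|x - y| * (1 / 2) ^+ n
  = (1 / 8) ^+ n * (512 * (4 ^+ n * `|x - y|)) :> R.
  have -> : (1 / 2 : R) ^+ n = (1 / 8) ^+ n * 4 ^+ n.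
    by rewrite -exprMn; congr (_ ^+ _); field.
  by ring.
rewrite ler_wpM2l//; apply: (le_trans (dblock_lip _ _ _)).
by rewrite -mulrBr normrM normrX normrN (@ger0_norm _ 4)// lexx.
Qed.

(** Multiplying by u removes the alternation of the signs: the n-th term is
    then (1/32)^n z B'(z) with z = (-4)^n u. *)
Lemma mul_dprofile_ge0 (R : realType) (w : nat -> bool) (u : R) :
  0 <= u * dprofile w u.
Proof.
have cu := @dprofile_cvg _ w u.
rewrite /dprofile -lim_seriesM//; apply: limr_ge; first exact: is_cvg_seriesM.
apply: nearW => n; rewrite /series /=; apply: sumr_ge0 => k _.
rewrite /dprofile_term /=.
set l := (-4) ^+ k.
have lE : (- (1 / 8)) ^+ k = (1 / 32) ^+ k * l.
  by rewrite /l -exprMn; congr (_ ^+ _); field.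
have -> : u * ((- (1 / 8)) ^+ k * dblock (w k) (l * u))
  = (1 / 32) ^+ k * (l * u * dblock (w k) (l * u)) by rewrite lE; ring.
by apply: mulr_ge0; [apply: exprn_ge0; lra|exact: mul_dblock_ge0].
Qed.

(** Some (-4)^n u has absolute value in ]1/8, 1/2], where the slopes of the
    blocks do not vanish; all the other terms have the right sign. *)
Lemma mul_dprofile_gt0 (R : realType) (w : nat -> bool) (u : R) :
  u != 0 -> `|u| <= 1 / 2 -> 0 < u * dprofile w u.
Proof.
have step v (x : R) : x * dprofile v x = x * dblock (v 0%N) x
    + (- 4 * x * dprofile (shift_word v) (- 4 * x)) / 32.
  by rewrite dprofile_rec; field.
have first_scale v (x : R) : 1 / 8 < `|x| -> `|x| <= 1 / 2 ->
    0 < x * dprofile v x.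
  move=> x8 x2; rewrite step.
  have := mul_dprofile_ge0 (shift_word v) (- 4 * x).
  have : 0 < x * dblock (v 0%N) x by apply: mul_dblock_gt0; lra.
  by lra.
move=> u0 u2; have [n] : exists n, 1 / 8 < 4 ^+ n * `|u|.
  apply: contrapT => /forallNP h; move/eqP: u0; apply.
  apply: (@eq0_geometric_bound _ u (1 / 8) (1 / 4)); first lra.
  move=> n; have /negP := h n; rewrite -leNgt => un.
  have p0 : 0 < (4 : R) ^+ n by rewrite exprn_gt0.
  rewrite -(ler_pM2l p0) [leRHS]mulrCA -exprMn.
  rewrite (_ : 4 * (1 / 4) = 1); last by field.
  by rewrite expr1n mulr1.
elim: n w u u0 u2 => [|n IH] w u u0 u2 un.
  by apply: first_scale => //; move: un; rewrite expr0; lra.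
have [u8|u8] := ltP (1 / 8) `|u|; first exact: first_scale.
rewrite step dblock_core// mulr0 add0r divr_gt0// IH//.
- by rewrite mulf_neq0// oppr_eq0.
- by rewrite normrM normrN (@ger0_norm _ 4)//; lra.
- by rewrite normrM normrN (@ger0_norm _ 4)// mulrA -exprSr.
Qed.

Lemma profile_bound (R : realType) (w : nat -> bool) (u : R) :
  `|profile w u| <= 512.
Proof.
apply: le_trans (_ : 8192 / 31 <= 512); last lra.
rewrite (_ : 8192 / 31 = 256 / (1 - 1 / 32)); last by field.
by apply: geometric_dominated_lim (profile_term_bound w u); lra.
Qed.

Lemma dprofile_bound (R : realType) (w : nat -> bool) (u : R) :
  `|dprofile w u| <= 1024.
Proof.
apply: le_trans (_ : 4096 / 7 <= 1024); last lra.
rewrite (_ : 4096 / 7 = 512 / (1 - 1 / 8)); last by field.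
by apply: geometric_dominated_lim (dprofile_term_bound w u); lra.
Qed.

(** The ratio is that of the series of the derivatives, so that together with
    [dprofile_close] this bounds the C^1 distance at a single rate. *)
Lemma profile_close (R : realType) (w w' : nat -> bool) (u : R) (n : nat) :
  (forall i, (i < n)%N -> w i = w' i) ->
  `|profile w u - profile w' u| <= 1024 * (1 / 8) ^+ n.
Proof.
elim: n w w' u => [|n IH] w w' u ww'.
  rewrite expr0 mulr1; apply: (le_trans (ler_normB _ _)).
  by have := profile_bound w u; have := profile_bound w' u; lra.
rewrite (_ : _ - _ = (profile (shift_word w) (- 4 * u)
    - profile (shift_word w') (- 4 * u)) / 32); last first.
  by rewrite (profile_rec w) (profile_rec w') ww'//; field.
rewrite normrM [X in _ * X]ger0_norm; last lra.
have := IH (shift_word w) (shift_word w') (- 4 * u) (fun i => ww' i.+1).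
have q0 : 0 <= (1 / 8 : R) ^+ n by apply: exprn_ge0; lra.
by rewrite exprS; lra.
Qed.

Lemma dprofile_close (R : realType) (w w' : nat -> bool) (u : R) (n : nat) :
  (forall i, (i < n)%N -> w i = w' i) ->
  `|dprofile w u - dprofile w' u| <= 2048 * (1 / 8) ^+ n.
Proof.
elim: n w w' u => [|n IH] w w' u ww'.
  rewrite expr0 mulr1; apply: (le_trans (ler_normB _ _)).
  by have := dprofile_bound w u; have := dprofile_bound w' u; lra.
rewrite (_ : _ - _ = - (dprofile (shift_word w) (- 4 * u)
    - dprofile (shift_word w') (- 4 * u)) / 8); last first.
  by rewrite (dprofile_rec w) (dprofile_rec w') ww'//; field.
rewrite normrM normrN.
rewrite [X in _ * X]ger0_norm; last lra.
have := IH (shift_word w) (shift_word w') (- 4 * u) (fun i => ww' i.+1).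
by rewrite exprS; lra.
Qed.

(** For |u| >= 1 every block in the series is on one of its tails, and these
    alternate.  The values 2 and 1 solve 2 = 63/32 + 1/32 and
    1 = 15/16 + 2/32. *)
Lemma profile_tail (R : realType) (w : nat -> bool) (u : R) :
  1 <= `|u| -> profile w u = if 0 < u then 2 else 1.
Proof.
move=> u1; apply/eqP; rewrite -subr_eq0; apply/eqP.
apply: (@eq0_geometric_bound _ _ 1024 (1 / 32)); first lra.
move=> n; elim: n w u u1 => [|n IH] w u u1.
  rewrite expr0 mulr1; have := profile_bound w u.
  by rewrite !ler_norml; case: ifP => _ /andP[? ?]; apply/andP; split; lra.
have {}IH := IH (shift_word w) (- 4 * u).
have : 1 <= `|- 4 * u| by rewrite normrM normrN (@ger0_norm _ 4)//; lra.
move=> /IH; rewrite (profile_rec w u) exprS.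
case: ltP => u0; case: ltP => u0'; try lra.
- rewrite block_left_tail; last by have := ler0_norm u0' => ?; lra.
  by rewrite !ler_norml => /andP[? ?]; apply/andP; split; lra.
- rewrite block_right_tail; last by have := ger0_norm (ltW u0') => ?; lra.
  by rewrite !ler_norml => /andP[? ?]; apply/andP; split; lra.
- have u00 : u = 0 by lra.
  by move: u1; rewrite u00 normr0; lra.
Qed.

Lemma profile_core (R : realType) (w : nat -> bool) (u : R) :
  `|u| <= 1 / 8 -> profile w u = profile (shift_word w) (- 4 * u) / 32.
Proof. by move=> u8; rewrite profile_rec block_core// add0r. Qed.

Lemma profile_right (R : realType) (w : nat -> bool) (u : R) :
  15 / 32 <= u <= 1 / 2 -> profile w u = 1 - 4 * (1 / 2 - u).
Proof.
move=> /[dup] /andP[? ?] ur; rewrite profile_rec block_right_affine//.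
rewrite profile_tail; last by rewrite ler0_norm; lra.
by rewrite ifF; [lra|apply/negbTE; rewrite -leNgt; lra].
Qed.

Lemma profile_left (R : realType) (w : nat -> bool) (u : R) :
  - (1 / 2) <= u <= - (3 / 8) -> profile w u = 5 / 8 - 2 * (u + 1 / 2).
Proof.
move=> /[dup] /andP[? ?] ul; rewrite profile_rec block_left_affine//.
rewrite profile_tail; last by rewrite ger0_norm; lra.
by rewrite ifT; lra.
Qed.

(** At 27/64 the words are compared through their first letters only: the
    later blocks are on their tails. *)
Lemma profile_probe (R : realType) (w w' : nat -> bool) :
  profile w (27 / 64) - profile w' (27 / 64)
    = ((w 0%N)%:R - (w' 0%N)%:R) / 64 :> R.
Proof.
have t v : profile v (- 4 * (27 / 64)) = 1 :> R.
  by rewrite profile_tail ?ifF// ?ler0_norm; try lra; apply/negbTE; lra.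
by rewrite !(profile_rec _ (27 / 64)) !t !(block_probe _ (_ 0%N)); lra.
Qed.

Lemma profile0 (R : realType) (w : nat -> bool) : profile w (0 : R) = 0.
Proof.
apply: (@eq0_geometric_bound _ _ 512 (1 / 32)); first lra.
move=> n; elim: n w => [|n IH] w; first by rewrite expr0 mulr1 profile_bound.
rewrite profile_core; last by rewrite normr0; lra.
rewrite mulr0 normrM [X in _ * X]ger0_norm; last lra.
by have := IH (shift_word w); rewrite exprS; lra.
Qed.

Lemma dprofile0 (R : realType) (w : nat -> bool) : dprofile w (0 : R) = 0.
Proof.
apply: (@eq0_geometric_bound _ _ 1024 (1 / 8)); first lra.
move=> n; elim: n w => [|n IH] w; first by rewrite expr0 mulr1 dprofile_bound.
rewrite dprofile_rec dblock_core ?normr0; last lra.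
rewrite mulr0 sub0r normrN normrM [X in _ * X]ger0_norm; last lra.
by have := IH (shift_word w); rewrite exprS; lra.
Qed.

Lemma profile_nondecreasing (R : realType) (w : nat -> bool) (x y : R) :
  0 <= x -> x <= y -> profile w x <= profile w y.
Proof.
move=> x0 xy; apply: (taylor_nondecreasing (profile_taylor w)) => //.
move=> z /andP[xz _]; have [z0|z0] := ltP 0 z.
  by rewrite -(pmulr_rge0 _ z0) mul_dprofile_ge0.
by rewrite (_ : z = 0) ?dprofile0//; lra.
Qed.

Lemma profile_nonincreasing (R : realType) (w : nat -> bool) (x y : R) :
  x <= y -> y <= 0 -> profile w y <= profile w x.
Proof.
move=> xy y0.
have := @taylor_nondecreasing R (fun z => profile w (- z))
  (fun z => - dprofile w (- z)) 512 (- y) (- x).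
rewrite !opprK; apply; last lra.
- move=> a b; rewrite mulNr -mulrN (_ : - (b - a) = - b - - a); last by ring.
  rewrite (_ : (b - a) ^+ 2 = (- b - - a) ^+ 2); last by ring.
  exact: profile_taylor.
- move=> z /andP[yz _]; have [z0|z0] := ltP 0 z.
    by rewrite -(pmulr_rge0 _ z0) mulrN -mulNr mul_dprofile_ge0.
  by rewrite (_ : z = 0) ?oppr0 ?dprofile0 ?oppr0//; lra.
Qed.

Lemma profile_half (R : realType) (w : nat -> bool) :
  profile w (1 / 2 : R) = 1.
Proof. by rewrite profile_right; lra. Qed.

Lemma profile_Nhalf (R : realType) (w : nat -> bool) :
  profile w (- (1 / 2) : R) = 5 / 8.
Proof. by rewrite profile_left; lra. Qed.

Lemma profile_itv (R : realType) (w : nat -> bool) (u : R) :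
  - (1 / 2) <= u <= 1 / 2 -> 0 <= profile w u <= 1.
Proof.
move=> /andP[ul ur]; have [u0|/ltW u0] := leP 0 u; apply/andP; split.
- by rewrite -(profile0 R w) profile_nondecreasing.
- by rewrite -(profile_half R w) profile_nondecreasing.
- by rewrite -(profile0 R w) profile_nonincreasing.
- by have := profile_nonincreasing w ul u0; rewrite profile_Nhalf; lra.
Qed.

Lemma profile_zoom_itv (R : realType) (w : nat -> bool) (x : R) :
  3 / 8 <= x <= 5 / 8 ->
  0 <= profile (shift_word w) (- 4 * (x - 1 / 2)) <= 1.
Proof. by move=> /andP[? ?]; apply: profile_itv; lra. Qed.

(** * The maps are renormalizable *)

Definition chaotic_map (R : realType) (w : nat -> bool) : C1space R :=
  (fun x => 1 - profile w (x - 1 / 2)) \_ (@unit_itv R).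

Lemma unit_itvP (R : realType) (x : R) : unit_itv x <-> 0 <= x <= 1.
Proof. by rewrite /unit_itv /= in_itv. Qed.

Lemma chaotic_mapE (R : realType) (w : nat -> bool) (x : R) :
  0 <= x <= 1 -> chaotic_map w x = 1 - profile w (x - 1 / 2).
Proof. by move=> /unit_itvP x01; rewrite /chaotic_map patchT// inE. Qed.

Lemma chaotic_map_middle (R : realType) (w : nat -> bool) (x : R) :
  3 / 8 <= x <= 5 / 8 ->
  chaotic_map w x = 1 - profile (shift_word w) (- 4 * (x - 1 / 2)) / 32.
Proof.
move=> /andP[? ?]; rewrite chaotic_mapE; last lra.
by rewrite profile_core// ler_norml; lra.
Qed.

Lemma chaotic_map_right (R : realType) (w : nat -> bool) (x : R) :
  31 / 32 <= x <= 1 -> chaotic_map w x = 4 * (1 - x).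
Proof.
move=> /andP[? ?]; rewrite chaotic_mapE; last lra.
by rewrite profile_right; lra.
Qed.

Lemma chaotic_map_left (R : realType) (w : nat -> bool) (x : R) :
  0 <= x <= 1 / 8 -> chaotic_map w x = 3 / 8 + 2 * x.
Proof.
move=> /andP[? ?]; rewrite chaotic_mapE; last lra.
by rewrite profile_left; lra.
Qed.

Lemma chaotic_map_middle_itv (R : realType) (w : nat -> bool) (x : R) :
  3 / 8 <= x <= 5 / 8 -> 31 / 32 <= chaotic_map w x <= 1.
Proof.
move=> xJ; rewrite chaotic_map_middle//.
by have := profile_zoom_itv w xJ; lra.
Qed.

Lemma chaotic_map0 (R : realType) (w : nat -> bool) :
  chaotic_map w (0 : R) = 3 / 8.
Proof. by rewrite chaotic_map_left; lra. Qed.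

Lemma chaotic_map4 (R : realType) (w : nat -> bool) :
  iter 4 (chaotic_map w) (0 : R) = 5 / 8.
Proof.
rewrite /= chaotic_map0 (@chaotic_map_middle _ w (3 / 8)); last lra.
rewrite (_ : - 4 * (3 / 8 - 1 / 2) = 1 / 2); last by field.
rewrite profile_half (@chaotic_map_right _ w (1 - 1 / 32)); last lra.
by rewrite chaotic_map_left; lra.
Qed.

Lemma iter2_middle (R : realType) (w : nat -> bool) (x : R) :
  3 / 8 <= x <= 5 / 8 ->
  iter 2 (chaotic_map w) x = profile (shift_word w) (- 4 * (x - 1 / 2)) / 8.
Proof.
move=> xJ; rewrite /= chaotic_map_right ?chaotic_map_middle_itv//.
by rewrite chaotic_map_middle//; lra.
Qed.

Lemma iter3_middle (R : realType) (w : nat -> bool) (x : R) :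
  3 / 8 <= x <= 5 / 8 ->
  iter 3 (chaotic_map w) x
    = 3 / 8 + profile (shift_word w) (- 4 * (x - 1 / 2)) / 4.
Proof.
move=> xJ; rewrite iterS iter2_middle//.
by have := profile_zoom_itv w xJ => ?; rewrite chaotic_map_left; lra.
Qed.

(** On J the third iterate is an affine image of the profile of the shifted
    word, and the conjugation by the orientation reversing x = 5/8 - t/4 turns
    - 4 (x - 1/2) into t - 1/2. *)
Lemma renorm_chaotic_map (R : realType) (w : nat -> bool) :
  renorm (chaotic_map w : C1space R) = chaotic_map (shift_word w).
Proof.
rewrite /renorm chaotic_map4 chaotic_map0.
apply/funext => t; rewrite /chaotic_map -/(chaotic_map w) !patchE.
case: ifPn => //; rewrite inE => /unit_itvP /andP[? ?].
have -> : (factor (5 / 8) (3 / 8) \o iter 3 (chaotic_map w)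
    \o line_path (5 / 8) (3 / 8)) t
  = factor (5 / 8) (3 / 8)
      (iter 3 (chaotic_map w) (line_path (5 / 8) (3 / 8) t)) by [].
rewrite iter3_middle /line_path; last lra.
rewrite (_ : - 4 * _ = t - 1 / 2); last by field.
by rewrite /factor; field; lra.
Qed.

(** Limits along this filter are therefore unique, which is what allows the
    value of [deriv01] to be computed, at the endpoints too. *)
Lemma within_unit_proper (R : realType) (x : R) : 0 <= x <= 1 ->
  ProperFilter (within (@unit_itv R) x^').
Proof.
move=> /andP[x0 x1]; split; last exact: within_filter.
rewrite /within /= => /nbhs_ballP[e /= e0 H].
pose d := Num.min (e / 2) (1 / 2).
have d0 : 0 < d by rewrite lt_min; lra.
have d1 : d <= 1 / 2 by rewrite ge_min lexx orbT.
have d2 : d <= e / 2 by rewrite ge_min lexx.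
have [xh|xh] := leP x (1 / 2).
- apply: (H (x + d)).
  + by rewrite /ball /= opprD addrA subrr sub0r normrN gtr0_norm//; lra.
  + by apply/eqP; lra.
  + by apply/unit_itvP; lra.
- apply: (H (x - d)).
  + by rewrite /ball /= opprB addrC subrK gtr0_norm//; lra.
  + by apply/eqP; lra.
  + by apply/unit_itvP; lra.
Qed.

Lemma diff_quot_cvg (R : realType) (f : R -> R) (K l x : R) : 0 < K ->
  unit_itv x ->
  (forall y, unit_itv y -> `|f y - f x - l * (y - x)| <= K * (y - x) ^+ 2) ->
  diff_quot f x y @[y --> within (@unit_itv R) x^'] --> l.
Proof.
move=> K0 xI fl; apply/cvgrPdist_le => e e0.
rewrite /within /=; apply/nbhs_ballP; exists (e / K); first exact: divr_gt0.
move=> y; rewrite /ball /= ltr_pdivlMr// => yx /eqP ynx yI.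
have yx0 : y - x != 0 by rewrite subr_eq0; apply/eqP.
rewrite distrC /diff_quot.
have -> : (f y - f x) / (y - x) - l = (f y - f x - l * (y - x)) / (y - x).
  by field.
rewrite normrM normfV ler_pdivrMr ?normr_gt0//.
apply: (le_trans (fl y yI)).
rewrite -real_normK ?num_real// expr2 mulrA ler_wpM2r//.
by rewrite mulrC distrC ltW.
Qed.

Lemma chaotic_map_diff_quot (R : realType) (w : nat -> bool) (x : R) :
  0 <= x <= 1 ->
  diff_quot (chaotic_map w) x y @[y --> within (@unit_itv R) x^']
    --> - dprofile w (x - 1 / 2).
Proof.
move=> x01; have xI : unit_itv x by apply/unit_itvP.
have K0 : 0 < 512 :> R by lra.
apply: (diff_quot_cvg K0 xI) => y /unit_itvP y01; rewrite !chaotic_mapE//.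
have := profile_taylor w (x - 1 / 2) (y - 1 / 2).
rewrite (_ : y - 1 / 2 - (x - 1 / 2) = y - x); last by ring.
by rewrite -normrN; congr (`| _ | <= _); ring.
Qed.

Lemma deriv_chaotic_map (R : realType) (w : nat -> bool) (x : R) :
  0 <= x <= 1 -> deriv01 (chaotic_map w) x = - dprofile w (x - 1 / 2).
Proof.
move=> x01; have FF := within_unit_proper x01.
rewrite /deriv01; apply: cvg_lim; first exact: Rhausdorff.
exact: chaotic_map_diff_quot.
Qed.

Lemma deriv_chaotic_map_lip (R : realType) (w : nat -> bool) (x y : R) :
  0 <= x <= 1 -> 0 <= y <= 1 ->
  `|deriv01 (chaotic_map w) x - deriv01 (chaotic_map w) y| <= 1024 * `|x - y|.
Proof.
move=> x01 y01; rewrite !deriv_chaotic_map// -opprD normrN.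
have := dprofile_lip w (x - 1 / 2) (y - 1 / 2).
by rewrite (_ : x - 1 / 2 - (y - 1 / 2) = x - y); last by ring.
Qed.

Lemma chaotic_map_C1Lip (R : realType) (w : nat -> bool) :
  C1Lip (chaotic_map w : R -> R).
Proof.
have [K K0 fK] : exists2 K : R, 0 < K &
    forall x y, 0 <= x <= 1 -> 0 <= y <= 1 ->
    `|deriv01 (chaotic_map w) x - deriv01 (chaotic_map w) y| <= K * `|x - y|.
  by exists 1024; [lra|exact: deriv_chaotic_map_lip].
split; last first.
  have PF : ProperFilter (globally (@unit_itv R `*` @unit_itv R)).
    apply: (@globally_properfilter _ _ (0, 0)).
    by split; apply/unit_itvP; rewrite lexx ler01.
  apply: (@klipschitzW _ _ _ K).
  move=> [x y] [/= /unit_itvP xI /unit_itvP yI].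
  exact: fK.
split.
  move=> x /unit_itvP x01; apply/cvg_ex; eexists.
  exact: chaotic_map_diff_quot x01.
apply/subspace_continuousP => x /unit_itvP xI.
apply/cvgrPdist_le => e e0; rewrite /within /=.
apply/nbhs_ballP; exists (e / K); first exact: divr_gt0.
move=> y; rewrite /ball /= ltr_pdivlMr// mulrC => yx /unit_itvP yI.
by apply: (le_trans (fK _ _ xI yI)); exact: ltW.
Qed.

Lemma chaotic_map_unimodal (R : realType) (w : nat -> bool) :
  unimodal (chaotic_map w : R -> R) (1 / 2).
Proof.
have hlf : unit_itv (1 / 2 : R) by apply/unit_itvP; lra.
split.
- by apply/funext => x; rewrite /chaotic_map !patchE; case: ifP => // ->.
- move=> _ [x /unit_itvP x01 <-]; apply/unit_itvP.
  rewrite chaotic_mapE//.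
  have : 0 <= profile w (x - 1 / 2) <= 1.
    by apply: profile_itv; move: x01 => /andP[? ?]; lra.
  by lra.
- by have [] := chaotic_map_C1Lip R w.
- apply/seteqP; split => x /=; last first.
    move=> ->; split => //.
    rewrite deriv_chaotic_map; last exact/unit_itvP.
    by rewrite subrr dprofile0 oppr0.
  move=> [/unit_itvP x01]; rewrite deriv_chaotic_map// => d0.
  apply: contrapT => /eqP xh.
  have : 0 < (x - 1 / 2) * dprofile w (x - 1 / 2).
    apply: mul_dprofile_gt0; first by rewrite subr_eq0.
    by move: x01 => /andP[? ?]; rewrite ler_norml; lra.
  by rewrite (_ : dprofile _ _ = 0) ?mulr0 ?ltxx//; lra.
- rewrite chaotic_mapE; last exact/unit_itvP.
  by rewrite subrr profile0 subr0 chaotic_map_right ?subrr ?mulr0//; lra.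
Qed.

Lemma chaotic_map_renormalizable (R : realType) (w : nat -> bool) :
  renormalizable (chaotic_map w : R -> R).
Proof.
have Jitv (x : R) : tripling_itv (chaotic_map w) x <-> 3 / 8 <= x <= 5 / 8.
  by rewrite /tripling_itv chaotic_map4 chaotic_map0 /= in_itv.
have fJ y : (chaotic_map w @` tripling_itv (chaotic_map w)) y ->
    31 / 32 <= y <= (1 : R).
  by move=> [x /Jitv xJ <-]; exact: chaotic_map_middle_itv.
have ffJ y : (iter 2 (chaotic_map w) @` tripling_itv (chaotic_map w)) y ->
    0 <= y <= (1 / 8 : R).
  move=> [x /Jitv xJ <-]; rewrite iter2_middle//.
  by have := profile_zoom_itv w xJ; lra.
have disj (A B : set R) : (forall x, A x -> B x -> False) ->
    interiors_disjoint A B.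
  move=> AB; rewrite /interiors_disjoint -subset0 => x.
  by move=> [/interior_subset Ax /interior_subset Bx]; exact: AB Ax Bx.
exists (1 / 2); split.
- exact: chaotic_map_unimodal.
- by rewrite chaotic_map4 chaotic_map0; lra.
- split; first by move=> x /Jitv /andP[? ?]; apply/unit_itvP; lra.
  have I0 : unit_itv (0 : R) by apply/unit_itvP; lra.
  by move=> /(_ 0 I0) /Jitv /andP[? ?]; lra.
- split.
  + by apply: disj => x /ffJ /andP[? ?] /Jitv /andP[? ?]; lra.
  + by apply: disj => x /Jitv /andP[? ?] /fJ /andP[? ?]; lra.
  + by apply: disj => x /ffJ /andP[? ?] /fJ /andP[? ?]; lra.
  + by move=> x y /ffJ /andP[? ?] /Jitv /andP[? ?]; lra.
  + by move=> x y /Jitv /andP[? ?] /fJ /andP[? ?]; lra.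
- move=> _ [x /Jitv xJ <-]; apply/Jitv; rewrite iter3_middle//.
  by have := profile_zoom_itv w xJ; lra.
Qed.

(** * Symbolic dynamics in the C^1 topology *)

Lemma C1_ballP (R : realType) (f g : C1space R) (e : R) : 0 < e ->
  ball f e g <-> forall x, unit_itv x ->
    `|f x - g x| < e /\ `|deriv01 f x - deriv01 g x| < e.
Proof.
move=> e0; split.
  move=> [/= fg dfg] x xI; have := fg x; have := dfg x.
  by rewrite /jet1 /= !patchT ?inE.
move=> H; split => /= x; rewrite /jet1 /= !patchE; case: ifPn => [|_];
  rewrite ?inE; try (by move=> _; exact: ballxx); try exact: ballxx.
- by move=> /H[].
- by move=> /H[].
Qed.

Lemma iter_renorm_chaotic_map (R : realType) (w : nat -> bool) (i : nat) :
  iter i (@renorm R) (chaotic_map w) = chaotic_map (iter i shift_word w).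
Proof. by elim: i => //= i ->; rewrite renorm_chaotic_map. Qed.

Lemma iter_shift_word (w : nat -> bool) (i j : nat) :
  iter i shift_word w j = w (i + j)%N.
Proof. by elim: i j => //= i IH j; rewrite /shift_word IH addnS. Qed.

Lemma one_subB (R : realType) (a b : R) : 1 - a - (1 - b) = b - a.
Proof. by ring. Qed.

(** After i renormalizations the letters of index i come first, and they are
    read off at x = 59/64, that is, at u = 27/64. *)
Lemma renorm_separates (R : realType) (w w' : nat -> bool) (i : nat) :
  w i != w' i ->
  ~ ball (iter i (@renorm R) (chaotic_map w)) (1 / 64)
      (iter i (@renorm R) (chaotic_map w')).
Proof.
move=> ww'; rewrite !iter_renorm_chaotic_map => /C1_ballP H.
have /H /(_ (59 / 64)) [] : 0 < 1 / 64 :> R by lra.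
  by apply/unit_itvP; lra.
rewrite !chaotic_mapE; try lra.
have -> : 59 / 64 - 1 / 2 = 27 / 64 :> R by field.
rewrite one_subB distrC profile_probe !iter_shift_word addn0 => + _.
move: ww'; case: (w i); case: (w' i) => // _.
- by rewrite mulr1n mulr0n subr0 ger0_norm ?ltxx//; lra.
- by rewrite mulr1n mulr0n sub0r mulNr normrN ger0_norm ?ltxx//; lra.
Qed.

Lemma cylinder_nbhs (w : cantor_space) (n : nat) :
  nbhs w [set w' : cantor_space | forall i, (i < n)%N -> w i = w' i].
Proof.
elim: n => [|n IH].
  by apply: (@filterS _ _ _ setT) => [w' _ i|]; [rewrite ltn0|exact: filterT].
have cn : nbhs w [set w' : cantor_space | w' n = w n].
  have := @proj_continuous nat (fun=> bool) n w.
  by move=> /(_ [set w n]); apply; exact: discrete_set1.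
apply: filterS2 IH cn => w' /= ww' wn i; rewrite ltnS leq_eqVlt.
by move=> /orP[/eqP ->|]; [exact/esym|exact: ww'].
Qed.

(** Words that agree on their first n letters give maps at C^1 distance
    O((1/8)^n). *)
Lemma chaotic_map_continuous (R : realType) :
  continuous (@chaotic_map R : cantor_space -> C1space R).
Proof.
move=> w; apply/cvg_ballP => e e0.
have [n ne] : exists n, 2048 * (1 / 8) ^+ n < e.
  apply: contrapT => /forallNP h.
  have e00 : e = 0.
    apply: (@eq0_geometric_bound _ _ 2048 (1 / 8)); first lra.
    by move=> n; rewrite gtr0_norm// leNgt; apply/negP; exact: h.
  by move: e0; rewrite e00 ltxx.
apply: filterS (cylinder_nbhs w n) => w' /= ww'.
apply/C1_ballP => // x /unit_itvP x01; split.
  rewrite !chaotic_mapE// one_subB distrC.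
  apply: le_lt_trans (profile_close _ ww') _.
  by apply: le_lt_trans ne; rewrite ler_wpM2r ?exprn_ge0//; lra.
rewrite !deriv_chaotic_map// -opprD normrN.
exact: le_lt_trans (dprofile_close _ ww') ne.
Qed.

Definition chaotic_set (R : realType) : set (C1space R) :=
  range (@chaotic_map R).

Lemma deriv_chaotic_map_middle (R : realType) (w : nat -> bool) (x : R) :
  3 / 8 <= x <= 5 / 8 -> deriv01 (chaotic_map w) x
    = dprofile (shift_word w) (- 4 * (x - 1 / 2)) / 8.
Proof.
move=> /andP[? ?]; rewrite deriv_chaotic_map; last lra.
rewrite dprofile_rec dblock_core ?sub0r ?opprK//.
by rewrite ler_norml; lra.
Qed.

(** On these maps renormalization only zooms in on J: it multiplies the
    differences of the values by 32 and those of the derivatives by 8. *)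
Lemma renorm_lipschitz (R : realType) (f g : C1space R) (e : R) : 0 < e ->
  chaotic_set f -> chaotic_set g ->
  ball f (e / 32) g -> ball (renorm f) e (renorm g).
Proof.
move=> e0 [w _ <-] [w' _ <-]; rewrite !renorm_chaotic_map.
have e32 : 0 < e / 32 by lra.
move=> /(C1_ballP _ _ e32) fg; apply/C1_ballP => // x /unit_itvP x01.
pose y := 5 / 8 - x / 4.
have yJ : 3 / 8 <= y <= 5 / 8 by rewrite /y; move: x01 => /andP[? ?]; lra.
have yx : - 4 * (y - 1 / 2) = x - 1 / 2 by rewrite /y; field.
have [] := fg y; first by apply/unit_itvP; move: yJ => /andP[? ?]; lra.
rewrite !(chaotic_map_middle _ yJ) !(deriv_chaotic_map_middle _ yJ) yx.
rewrite !(chaotic_mapE _ x01) !(deriv_chaotic_map _ x01).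
rewrite !one_subB -mulrBl -mulrBl -opprD.
rewrite !normrM normrN normfV (@ger0_norm _ 32)// normfV (@ger0_norm _ 8)//.
by move=> ? ?; split; lra.
Qed.

Lemma chaotic_set_admissible (R : realType) : admissible_set (@chaotic_set R).
Proof.
split.
- apply: (@continuous_compact cantor_space (C1space R) (@chaotic_map R) setT).
    exact/continuous_subspaceT/chaotic_map_continuous.
  exact: cantor_space_compact.
- move=> _ [w _ <-]; split; first exact: chaotic_map_renormalizable.
  exact: chaotic_map_C1Lip.
- move=> _ [_ [w _ <-] <-]; rewrite renorm_chaotic_map.
  by exists (shift_word w).
- apply/subspace_continuousP => f Lf; apply/cvg_ballP => e e0.
  rewrite /within /=; apply/nbhs_ballP; exists (e / 32).
    by rewrite /=; lra.
  by move=> g fg Lg; exact: renorm_lipschitz.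
Qed.

(** * Entropy *)

Lemma tuple_neq_nth (n : nat) (t t' : n.-tuple bool) : t != t' ->
  exists2 i, (i < n)%N & nth false t i != nth false t' i.
Proof.
move=> tt'; apply: contrapT => H; move/eqP: tt'; apply.
apply: eq_from_tnth => i; rewrite !(tnth_nth false); apply/eqP.
by apply: contrapT => /negP ti; apply: H; exists i.
Qed.

Lemma separation_number_ge (R : realType) (n : nat) :
  ((2 ^ n)%:R%:E <=
   separation_number (@renorm R) (@chaotic_set R) n (1 / 64))%E.
Proof.
pose word (t : n.-tuple bool) : C1space R := chaotic_map (nth false t).
have sep t t' : t != t' -> exists2 i, (i < n)%N &
    ~ ball (iter i (@renorm R) (word t)) (1 / 64)
        (iter i (@renorm R) (word t')).
  move=> /tuple_neq_nth[i ni tt']; exists i => //.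
  exact: renorm_separates.
have winj : injective word.
  move=> t t' tt'; apply: contrapT => /eqP /sep [i _]; apply.
  by rewrite tt'; apply: ballxx; lra.
apply: ereal_sup_ubound; exists [fset word t | t in {: n.-tuple bool}]%fset.
  split.
    by move=> f /= /imfsetP[t _ ->]; exists (nth false t).
  move=> _ _ /imfsetP[t _ ->] /imfsetP[t' _ ->] tt'; apply: sep.
  by apply: contraNneq tt' => ->.
by rewrite card_imfset//= -cardE card_tuple card_bool.
Qed.

Lemma separation_growth_ge (R : realType) :
  ((ln 2)%:E <= separation_growth (@renorm R) (@chaotic_set R) (1 / 64))%E.
Proof.
rewrite /separation_growth /limn_esup limf_esupE.
apply: le_ereal_inf_tmp => _ [V [N _ NV] <-].
apply: (@le_trans _ _ ((N.+1%:R^-1)%:E *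
  lne (separation_number (@renorm R) (@chaotic_set R) N.+1 (1 / 64)))%E).
  have : (lne (2 ^ N.+1)%:R%:E <=
      lne (separation_number (@renorm R) (@chaotic_set R) N.+1 (1 / 64)))%E.
    have sn := separation_number_ge R N.+1.
    rewrite lee_lne// in_itv/= leey andbT ?lee_fin//.
    by apply: le_trans sn; rewrite lee_fin.
  rewrite lne_EFin; last by rewrite ltr0n expn_gt0.
  rewrite natrX lnXn; last by rewrite ltr0n.
  have NE : (N.+1%:R^-1 : R) * (ln 2 *+ N.+1) = ln 2.
    by rewrite -[ln 2 *+ _]mulr_natl mulKf// pnatr_eq0.
  by move=> /(lee_wpmul2l _); rewrite -{2}NE EFinM; apply; rewrite lee_fin.
by apply: ereal_sup_ubound; exists N.+1 => //; apply: NV => /=.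
Qed.

Theorem theorem2p9 (R : realType) : (0 < renorm_entropy R)%E.
Proof.
apply: (@lt_le_trans _ _ (ln 2)%:E); first by rewrite lte_fin ln_gt0 ?ltr1n.
apply: (le_trans (separation_growth_ge R)).
apply: (@le_trans _ _ (topological_entropy (@renorm R) (@chaotic_set R))).
  by apply: ereal_sup_ubound; exists (1 / 64) => //=; lra.
apply: ereal_sup_ubound; exists (@chaotic_set R) => //.
exact: chaotic_set_admissible.
Qed.
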